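(* Let $\alpha: I\to\mathbb{R}^3$ be a space curve parametrized by arc-length $s$, with nowhere vanishing curvature, unit principal normal vector $N$ and unit Darboux vector $C$, whose Darboux indicatrix is a regular curve. Let $\sigma=\int_0^s\|C'(s)\|\,ds$ be the arc-length parameter of the Darboux indicatrix of $\alpha$, and regard $N$ and $C$ as functions of $\sigma$. Let $a,\theta$ be constant real numbers (with $\cot\theta$ defined), let $c\in\mathbb{R}^3$ be a constant vector, and let $\sigma_0$ be a fixed parameter value. Then $$\tilde\gamma_C(\sigma)=a\int_{\sigma_0}^{\sigma}C(\sigma)\,d\sigma+a\cot\theta\int_{\sigma_0}^{\sigma}N(\sigma)\,d\sigma+c$$ is a Bertrand curve.
   Context: For a unit speed curve $\alpha$ in $\mathbb{R}^3$: $T=\alpha'$, the curvature is $\kappa=\|\alpha''\|$, and where $\kappa\neq0$ the unit principal normal $N$ is defined by $\alpha''=\kappa N$ and the unit binormal is $B=T\times N$. The torsion $\tau$ is defined by the Frenet-Serret formulae $T'=\kappa N$, $N'=-\kappa T+\tau B$, $B'=-\tau N$. The Darboux vector field is $W=\tau T+\kappa B$ and the unit Darboux vector is $C=W/\|W\|=\dfrac{\tau T+\kappa B}{\sqrt{\tau^2+\kappa^2}}$. The Darboux indicatrix $(C)$ is the curve on the unit sphere $\mathbb{S}^2$ traced by $C(s)$. Convention: curves are regular and, wherever the Frenet frame is used, have nowhere vanishing curvature; this applies also to the curve $\tilde\gamma_C$ (i.e. $a,\theta$ are such that it is a regular curve with nonvanishing curvature). A Bertrand curve is a curve in $\mathbb{R}^3$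 which shares its principal normals with another curve (its Bertrand mate). The characterization used in the paper: a curve with curvature $\kappa$ and torsion $\tau$ is a Bertrand curve if and only if there exist non-zero real numbers $A,B$ such that $A\kappa+B\tau=1$ at every parameter value.
   Formalization: Nonzero A, B with Aκ+Bτ=1 are asserted only if cot θ≠0, since they can fail when cot θ=0; in all cases a Bertrand mate is given, allowed to be singular only at zeros of a not identically vanishing torsion, where no regular mate exists. *)

(* Defs.v *)
From Stdlib Require Export Reals.
From Coquelicot Require Export Coquelicot.

Open Scope R_scope.

(* Linear structure on R^3: Coquelicot's [plus], [scal], [zero] on products. *)
Definition vec : Type := (R * R * R)%type.

Definition vx (v : vec) : R := fst (fst v).
Definition vy (v : vec) : R := snd (fst v).
Definition vz (v : vec) : R := snd v.

Definition dot (v w : vec) : R := vx v * vx w + vy v * vy w + vz v * vz w.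

Definition cross (v w : vec) : vec :=
  (vy v * vz w - vz v * vy w,
   vz v * vx w - vx v * vz w,
   vx v * vy w - vy v * vx w).

Definition vnorm (v : vec) : R := sqrt (dot v v).

(* Componentwise, because [Derive] is real-valued and [RInt] needs a
   [CompleteNormedModule], a structure not provided for products. *)
Definition vderive (f : R -> vec) (t : R) : vec :=
  (Derive (fun x => vx (f x)) t,
   Derive (fun x => vy (f x)) t,
   Derive (fun x => vz (f x)) t).

Definition vint (f : R -> vec) (p q : R) : vec :=
  (RInt (fun x => vx (f x)) p q,
   RInt (fun x => vy (f x)) p q,
   RInt (fun x => vz (f x)) p q).

Definition Rbar_interval (lo hi : Rbar) (t : R) : Prop :=
  Rbar_lt lo t /\ Rbar_lt t hi.

(* Only used on domains [D] that are open intervals. *)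
Definition smooth_on (D : R -> Prop) (f : R -> vec) : Prop :=
  forall (n : nat) (t : R), D t ->
    ex_derive_n (fun x => vx (f x)) n t /\
    ex_derive_n (fun x => vy (f x)) n t /\
    ex_derive_n (fun x => vz (f x)) n t.

(* Frenet apparatus of a regular curve in an arbitrary parameter: d/ds is
   |g'|^-1 d/dt. For unit speed these are T = g', kappa = |g''|,
   g'' = kappa N, B = T x N and tau = <N', B>, the B-component of
   N' = - kappa T + tau B. *)
Definition tangent (g : R -> vec) (t : R) : vec :=
  scal (/ vnorm (vderive g t)) (vderive g t).

Definition curvature (g : R -> vec) (t : R) : R :=
  vnorm (vderive (tangent g) t) / vnorm (vderive g t).

Definition normal (g : R -> vec) (t : R) : vec :=
  scal (/ vnorm (vderive (tangent g) t)) (vderive (tangent g) t).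

Definition binormal (g : R -> vec) (t : R) : vec :=
  cross (tangent g t) (normal g t).

Definition torsion (g : R -> vec) (t : R) : R :=
  dot (vderive (normal g) t) (binormal g t) / vnorm (vderive g t).

Definition regular_on (D : R -> Prop) (g : R -> vec) : Prop :=
  forall t : R, D t -> vderive g t <> zero.

Definition curved_on (D : R -> Prop) (g : R -> vec) : Prop :=
  forall t : R, D t -> curvature g t <> 0.

Definition darboux (g : R -> vec) (t : R) : vec :=
  plus (scal (torsion g t) (tangent g t)) (scal (curvature g t) (binormal g t)).

Definition unit_darboux (g : R -> vec) (t : R) : vec :=
  scal (/ vnorm (darboux g t)) (darboux g t).

Definition line (p v q : vec) : Prop := exists r : R, q = plus p (scal r v).

(* [b] is a Bertrand mate of [g]: another curve with the same principal normal
   line at each parameter. The principal normal of [b] is carried by the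
   derivative of a smooth unit tangent field [u]. Where b' <> 0, u is the unit
   tangent of [b] up to a locally constant sign, so that u' spans the usual
   principal normal line (and b has non-zero curvature, because u' <> 0).

   A mate has the form b = g + l N with l a non-zero constant, hence
   b' = |g'| ((1 - l kappa) T + l tau B), and the angle between T and the
   tangent of b is constant. If tau vanishes somewhere but not everywhere,
   this forces b' = 0 at the zeros of tau, so no regular mate exists; only
   those singular points are allowed. If tau has no zero, or is identically
   zero, the mate is a regular curve with non-vanishing curvature. *)
Definition bertrand_mate (D : R -> Prop) (g b : R -> vec) : Prop :=
  smooth_on D b /\
  (forall t : R, D t -> b t <> g t) /\
  (forall t : R, D t -> vderive b t = zero ->
     torsion g t = 0 /\ exists t' : R, D t' /\ torsion g t' <> 0) /\
  exists u : R -> vec,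
    smooth_on D u /\
    forall t : R, D t ->
      vnorm (u t) = 1 /\
      (exists r : R, vderive b t = scal r (u t)) /\
      vderive u t <> zero /\
      (forall q : vec, line (b t) (vderive u t) q <-> line (g t) (normal g t) q).

Definition bertrand_curve (D : R -> Prop) (g : R -> vec) : Prop :=
  smooth_on D g /\ regular_on D g /\ curved_on D g /\
  exists b : R -> vec, bertrand_mate D g b.

Definition bertrand_relation (D : R -> Prop) (g : R -> vec) : Prop :=
  exists A B : R, A <> 0 /\ B <> 0 /\
    forall t : R, D t -> A * curvature g t + B * torsion g t = 1.

Definition cot (x : R) : R := cos x / sin x.

Definition indicatrix_arclength (alpha : R -> vec) (s : R) : R :=
  RInt (fun x => vnorm (vderive (unit_darboux alpha) x)) 0 s.

Definition image (I : R -> Prop) (f : R -> R) (y : R) : Prop :=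
  exists s : R, I s /\ y = f s.

(* [par] expresses the parameter s of [alpha] as a function of sigma. *)
Definition gamma_C (alpha : R -> vec) (par : R -> R)
    (a theta sigma0 : R) (c : vec) (sigma : R) : vec :=
  plus (plus
    (scal a (vint (fun x => unit_darboux alpha (par x)) sigma0 sigma))
    (scal (a * cot theta) (vint (fun x => normal alpha (par x)) sigma0 sigma)))
    c.

(* Main.v *)
(* Let [C] be the unit Darboux vector. Since [N x N' = W], we have [C = N x U]
   with [U = N'/|N'|], and both [N'] and [C'] are multiples of [U]. In the arc
   length of the Darboux indicatrix, [C' = e U], [N' = f U] and
   [U' = - f N - e C] with [f > 0] and [e] a constant sign. Put [k = cot theta];
   then [gamma' = a (C + k N)], the principal normal of [gamma] is [eta U] with
   [eta] a constant sign, and with [L = |gamma'|],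
   [kappa = eta a (e + k f) / L^2], [tau = a (f - e k) / L^2]. Hence
   [eta e a kappa - k e a tau = 1]. The curve [gamma + e a U] has velocity
   [a (k - e f) N], so it is a mate, with tangent [N], unless [f = e k]
   identically; then [gamma] is planar and [gamma - e a U] is a mate. *)

Require Import Defs.
From Stdlib Require Import Lra Classical Ranalysis5.
Open Scope R_scope.

(** * Smooth real functions *)

(** Order convexity is what the intermediate value theorem and integration ask of a domain. It
    passes to the image of an interval without any description of the end points of that image. *)
Definition convex (D : R -> Prop) : Prop :=
  forall x y z : R, D x -> D y -> x <= z <= y -> D z.

Lemma is_derive_Rmult (f g : R -> R) (t f' g' : R) :
  is_derive f t f' -> is_derive g t g' ->
  is_derive (fun x => f x * g x) t (f' * g t + f t * g').
Proof.
  intros Hf Hg.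
  exact (is_derive_mult f g t f' g' Hf Hg Rmult_comm).
Qed.

Lemma is_derive_Rcomp (f p : R -> R) (t f' p' : R) :
  is_derive f (p t) f' -> is_derive p t p' ->
  is_derive (fun x => f (p x)) t (p' * f').
Proof. exact (is_derive_comp f p t f' p'). Qed.

Lemma is_derive_continuity_pt (f : R -> R) (t l : R) :
  is_derive f t l -> continuity_pt f t.
Proof.
  intros H; apply continuity_pt_filterlim.
  apply (ex_derive_continuous f t); exists l; exact H.
Qed.

(** The derivative is an existential witness, constrained on [D] alone. Closure properties are then
    inductions on [n] that supply the usual derivative formula, with no iterated [Derive_n] to
    compute. *)
Fixpoint differentiable_n (D : R -> Prop) (n : nat) (f : R -> R) : Prop :=
  match n with
  | O => True
  | S m => exists f' : R -> R,
      (forall t, D t -> is_derive f t (f' t)) /\ differentiable_n D m f'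
  end.

Definition smooth (D : R -> Prop) (f : R -> R) : Prop :=
  forall n, differentiable_n D n f.

Section Smooth.

Variable D : R -> Prop.
Hypothesis D_open : open D.

Lemma differentiable_n_pred (n : nat) (f : R -> R) :
  differentiable_n D (S n) f -> differentiable_n D n f.
Proof.
  revert f; induction n as [|n IH]; intros f; [easy|].
  intros [f' [H1 H2]]; exists f'; split; [easy|].
  apply IH, H2.
Qed.

Lemma is_derive_ext_on (f g : R -> R) (t l : R) :
  D t -> (forall x, D x -> f x = g x) -> is_derive f t l -> is_derive g t l.
Proof.
  intros Dt E; apply is_derive_ext_loc.
  generalize (D_open t Dt); apply filter_imp; exact E.
Qed.

Lemma differentiable_n_ext (n : nat) (f g : R -> R) :
  (forall t, D t -> f t = g t) ->
  differentiable_n D n f -> differentiable_n D n g.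
Proof.
  destruct n as [|n]; intros E; [easy|].
  intros [f' [H1 H2]]; exists f'; split; [|easy].
  intros t Dt; apply (is_derive_ext_on f); auto.
Qed.

Lemma smooth_ext (f g : R -> R) :
  (forall t, D t -> f t = g t) -> smooth D f -> smooth D g.
Proof. intros E H n; apply (differentiable_n_ext n f); auto. Qed.

Lemma smooth_primitive (f f' : R -> R) :
  (forall t, D t -> is_derive f t (f' t)) -> smooth D f' -> smooth D f.
Proof. intros H S [|n]; [easy|]. exists f'; split; auto. Qed.

Lemma smooth_is_derive (f : R -> R) (t : R) :
  smooth D f -> D t -> is_derive f t (Derive f t).
Proof.
  intros H Dt; apply Derive_correct.
  destruct (H 1%nat) as [f' [Hf' _]]; exists (f' t); auto.
Qed.

Lemma smooth_Derive (f : R -> R) : smooth D f -> smooth D (Derive f).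
Proof.
  intros H n; destruct (H (S n)) as [f' [H1 H2]].
  apply (differentiable_n_ext n f'); [|easy].
  intros t Dt; symmetry; apply is_derive_unique; auto.
Qed.

(** Bridge to the smoothness used in the definitions. [ex_derive_n] adds derivatives on the outside
    while [differentiable_n] strips them from the inside; [Derive_n_comp] reconciles the two
    orders. *)
Lemma smooth_iff_ex_derive_n (f : R -> R) :
  smooth D f <-> (forall n t, D t -> ex_derive_n f n t).
Proof.
  split.
  - intros H n; revert f H; induction n as [|n IH]; intros f H t Dt; [easy|].
    destruct n as [|n].
    + exists (Derive f t); apply smooth_is_derive; auto.
    + generalize (IH (Derive f) (smooth_Derive f H) t Dt).
      apply ex_derive_ext; intros x.
      change (Derive_n (Derive_n f 1) n x = Derive_n f (S n) x).
      rewrite Derive_n_comp, Nat.add_1_r; reflexivity.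
  - intros H n; revert f H; induction n as [|n IH]; intros f H; [easy|].
    exists (Derive f); split.
    + intros t Dt; apply Derive_correct, (H 1%nat t Dt).
    + apply IH; intros [|m] t Dt; [easy|].
      generalize (H (S (S m)) t Dt).
      apply ex_derive_ext; intros x.
      change (Derive_n f (S m) x = Derive_n (Derive_n f 1) m x).
      rewrite Derive_n_comp, Nat.add_1_r; reflexivity.
Qed.

Lemma smooth_const (k : R) : smooth D (fun _ => k).
Proof.
  intros n; revert k; induction n as [|n IH]; intros k; [easy|].
  exists (fun _ => 0); split; [|easy].
  intros t _; exact (is_derive_const k t).
Qed.

Lemma differentiable_n_plus (n : nat) (f g : R -> R) :
  differentiable_n D n f -> differentiable_n D n g ->
  differentiable_n D n (fun t => f t + g t).
Proof.
  revert f g; induction n as [|n IH]; intros f g; [easy|].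
  intros [f' [F1 F2]] [g' [G1 G2]].
  exists (fun t => f' t + g' t); split; [|auto].
  intros t Dt; exact (is_derive_plus f g t _ _ (F1 t Dt) (G1 t Dt)).
Qed.

Lemma smooth_plus (f g : R -> R) :
  smooth D f -> smooth D g -> smooth D (fun t => f t + g t).
Proof. intros F G n; apply differentiable_n_plus; auto. Qed.

Lemma differentiable_n_mult (n : nat) (f g : R -> R) :
  differentiable_n D n f -> differentiable_n D n g ->
  differentiable_n D n (fun t => f t * g t).
Proof.
  revert f g; induction n as [|n IH]; intros f g; [easy|].
  intros F G.
  pose proof (differentiable_n_pred n f F) as F0.
  pose proof (differentiable_n_pred n g G) as G0.
  destruct F as [f' [F1 F2]], G as [g' [G1 G2]].
  exists (fun t => f' t * g t + f t * g' t); split.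
  - intros t Dt; apply is_derive_Rmult; auto.
  - apply differentiable_n_plus; auto.
Qed.

Lemma smooth_mult (f g : R -> R) :
  smooth D f -> smooth D g -> smooth D (fun t => f t * g t).
Proof. intros F G n; apply differentiable_n_mult; auto. Qed.

Lemma smooth_minus (f g : R -> R) :
  smooth D f -> smooth D g -> smooth D (fun t => f t - g t).
Proof.
  intros F G; apply (smooth_ext (fun t => f t + (-1) * g t)).
  - intros t _; ring.
  - apply smooth_plus; [easy|]; apply smooth_mult; [apply smooth_const|easy].
Qed.

(** The derivative of [/ f] is a product involving [/ f] itself, so the induction hypothesis for the
    same [f] at one order less suffices. The square root is treated in the same way. *)
Lemma differentiable_n_inv (n : nat) (f : R -> R) :
  (forall t, D t -> f t <> 0) ->
  differentiable_n D n f -> differentiable_n D n (fun t => / f t).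
Proof.
  intros Hf; induction n as [|n IH]; [easy|].
  intros F; pose proof (IH (differentiable_n_pred n f F)) as F0.
  destruct F as [f' [F1 F2]].
  exists (fun t => (f' t * (/ f t * / f t)) * -1); split.
  - intros t Dt; evar_last; [apply is_derive_inv; [apply F1, Dt|auto]|].
    field; auto.
  - apply differentiable_n_mult; [|apply smooth_const].
    repeat apply differentiable_n_mult; auto.
Qed.

Lemma smooth_inv (f : R -> R) :
  (forall t, D t -> f t <> 0) -> smooth D f -> smooth D (fun t => / f t).
Proof. intros Hf F n; apply differentiable_n_inv; auto. Qed.

Lemma differentiable_n_sqrt (n : nat) (f : R -> R) :
  (forall t, D t -> 0 < f t) ->
  differentiable_n D n f -> differentiable_n D n (fun t => sqrt (f t)).
Proof.
  intros Hf; induction n as [|n IH]; [easy|].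
  intros F; pose proof (IH (differentiable_n_pred n f F)) as F0.
  destruct F as [f' [F1 F2]].
  exists (fun t => f' t * / (2 * sqrt (f t))); split.
  - intros t Dt; apply is_derive_sqrt; auto.
  - apply differentiable_n_mult; [easy|]; apply differentiable_n_inv.
    + intros t Dt; generalize (sqrt_lt_R0 _ (Hf t Dt)); lra.
    + apply differentiable_n_mult; [apply smooth_const|easy].
Qed.

Lemma smooth_sqrt (f : R -> R) :
  (forall t, D t -> 0 < f t) -> smooth D f -> smooth D (fun t => sqrt (f t)).
Proof. intros Hf F n; apply differentiable_n_sqrt; auto. Qed.

Lemma smooth_continuity_pt (f : R -> R) (t : R) :
  smooth D f -> D t -> continuity_pt f t.
Proof.
  intros F Dt; apply (is_derive_continuity_pt f t (Derive f t)).
  apply smooth_is_derive; auto.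
Qed.

(** The integral must exist for every end point near [t]: openness keeps these end points in [D],
    and convexity keeps the segment joining them to [p] in [D], on whichever side of [p] they
    lie. *)
Lemma is_derive_RInt_on (f : R -> R) (p t : R) :
  convex D -> (forall x, D x -> continuity_pt f x) -> D p -> D t ->
  is_derive (fun x => RInt f p x) t (f t).
Proof.
  intros Dc Cf Dp Dt; apply is_derive_RInt with (a := p).
  - generalize (D_open t Dt); apply filter_imp; intros y Dy.
    apply (RInt_correct f), (ex_RInt_continuous f); intros z Hz.
    apply continuity_pt_filterlim, Cf.
    destruct (Rle_dec p y) as [H|H].
    + rewrite Rmin_left, Rmax_right in Hz by easy; exact (Dc p y z Dp Dy Hz).
    + rewrite Rmin_right, Rmax_left in Hz by lra; exact (Dc y p z Dy Dp Hz).
  - apply continuity_pt_filterlim, Cf, Dt.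
Qed.

(** A change of sign would produce a zero by the intermediate value theorem. The sign is delivered
    as a number so that it can serve as a coefficient in later formulas. *)
Lemma constant_sign (f : R -> R) (t0 : R) :
  convex D -> D t0 -> (forall x, D x -> continuity_pt f x) ->
  (forall x, D x -> f x <> 0) ->
  exists e, (e = 1 \/ e = -1) /\ forall x, D x -> 0 < e * f x.
Proof.
  intros Dc D0 Cf Nf.
  assert (IVT : forall (g : R -> R) x y, (forall x, D x -> continuity_pt g x) ->
    (forall x, D x -> g x <> 0) -> D x -> D y -> g x < 0 -> 0 < g y ->
    x < y -> False).
  { intros g x y Cg Ng Dx Dy gx gy xy.
    destruct (IVT_interv g x y) as [z [Hz Ez]]; auto.
    - intros u Hu; apply Cg, (Dc x y); auto.
    - apply (Ng z); [apply (Dc x y)|]; auto. }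
  assert (K : forall x y, D x -> D y -> f x < 0 -> 0 < f y -> False).
  { intros x y Dx Dy fx fy; destruct (Rtotal_order x y) as [H|[H|H]].
    - apply (IVT f x y); auto.
    - subst; lra.
    (* Here the positive value comes first, so it is [- f] that rises through zero between [y] and
       [x]. *)
    - apply (IVT (fun u => - f u) y x); auto; try lra.
      + intros u Du; apply (continuity_pt_opp f); auto.
      + intros u Du E; apply (Nf u Du); lra. }
  destruct (Rtotal_order (f t0) 0) as [H|[H|H]].
  - exists (-1); split; [auto|]; intros x Dx.
    destruct (Rtotal_order (f x) 0) as [L|[L|L]]; [lra|now elim (Nf x)|].
    elim (K t0 x); auto.
  - now elim (Nf t0).
  - exists 1; split; [auto|]; intros x Dx.
    destruct (Rtotal_order (f x) 0) as [L|[L|L]]; [|now elim (Nf x)|lra].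
    elim (K x t0); auto.
Qed.

End Smooth.

Lemma differentiable_n_comp (I J : R -> Prop) (n : nat) (f p : R -> R) :
  (forall t, J t -> I (p t)) ->
  differentiable_n I n f -> differentiable_n J n p ->
  differentiable_n J n (fun t => f (p t)).
Proof.
  intros JI; revert f; induction n as [|n IH]; intros f; [easy|].
  intros [f' [F1 F2]] P; pose proof (differentiable_n_pred J n p P) as P0.
  destruct P as [p' [P1 P2]].
  exists (fun t => p' t * f' (p t)); split.
  - intros t Jt; apply is_derive_Rcomp; auto.
  - apply differentiable_n_mult; auto.
Qed.

Lemma smooth_comp (I J : R -> Prop) (f p : R -> R) :
  (forall t, J t -> I (p t)) ->
  smooth I f -> smooth J p -> smooth J (fun t => f (p t)).
Proof. intros JI F P n; apply (differentiable_n_comp I); auto. Qed.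

(** Bootstrapping on the equation [p' = 1 / g(p)]: if [p] is [n] times differentiable, so is the
    right-hand side, and [p] gains one order. *)
Lemma smooth_inverse (I J : R -> Prop) (g p : R -> R) :
  (forall t, J t -> I (p t)) -> smooth I g -> (forall s, I s -> g s <> 0) ->
  (forall t, J t -> is_derive p t (/ g (p t))) -> smooth J p.
Proof.
  intros JI G Ng P n; induction n as [|n IH]; [easy|].
  exists (fun t => / g (p t)); split; [easy|].
  apply differentiable_n_inv; [auto|].
  apply (differentiable_n_comp I); auto.
Qed.

Lemma open_Rbar_interval (lo hi : Rbar) : open (Rbar_interval lo hi).
Proof. apply open_and; [apply open_Rbar_gt|apply open_Rbar_lt]. Qed.

Lemma convex_Rbar_interval (lo hi : Rbar) : convex (Rbar_interval lo hi).
Proof.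
  intros x y z [Hx _] [_ Hy] [xz zy]; split.
  - apply (Rbar_lt_le_trans lo x z); auto.
  - apply (Rbar_le_lt_trans z y hi); auto.
Qed.

(** * Inverse of an increasing function *)

Section InverseFunction.

Variables (lo hi : Rbar) (s s' p : R -> R).
Let I := Rbar_interval lo hi.
Let J := image I s.
Hypothesis s_derive : forall x, I x -> is_derive s x (s' x).
Hypothesis s'_pos : forall x, I x -> 0 < s' x.
Hypothesis sK : forall x, I x -> p (s x) = x.

Lemma s_increasing (x y : R) : I x -> I y -> x < y -> s x < s y.
Proof.
  intros [Hx _] [_ Hy] xy; apply (incr_function s lo hi s'); auto.
  - intros z H1 H2; apply s_derive; split; auto.
  - intros z H1 H2; apply s'_pos; split; auto.
Qed.

Lemma s_surjective (x y v : R) :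
  I x -> I y -> x <= y -> s x <= v <= s y -> exists z, x <= z <= y /\ s z = v.
Proof.
  (* [IVT_interv] requires strict signs at both ends, so values attained at an end point are settled
     first. *)
  intros Ix Iy xy [[H1|H1] [H2|H2]]; try (exists x; split; [lra|]; congruence);
    [|exists y; split; [lra|congruence]].
  destruct (Rle_lt_or_eq_dec x y xy) as [L|E]; [|subst; lra].
  destruct (IVT_interv (fun z => s z - v) x y) as [z [Hz Ez]]; try lra.
  - intros z Hz; apply continuity_pt_minus.
    + apply (is_derive_continuity_pt s z (s' z)), s_derive.
      apply (convex_Rbar_interval lo hi x y); auto.
    + apply continuity_pt_const; intros ? ?; reflexivity.
  - exists z; split; [auto|lra].
Qed.

Lemma image_in (t : R) : J t -> I (p t) /\ s (p t) = t.
Proof. intros [x [Ix ->]]; rewrite sK; auto. Qed.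

Lemma image_convex : convex J.
Proof.
  intros t1 t2 t [x [Ix ->]] [y [Iy ->]] Ht.
  destruct (Rle_lt_dec x y) as [H|H].
  - destruct (s_surjective x y t Ix Iy H Ht) as [z [Hz <-]].
    exists z; split; [|easy]; apply (convex_Rbar_interval lo hi x y); auto.
  - generalize (s_increasing y x Iy Ix H); lra.
Qed.

(** By monotonicity and the intermediate value theorem, the image of a small segment around [x]
    covers a neighbourhood of [s x]. This yields at once the openness of [J] and the continuity of
    [p]. *)
Lemma image_nbhd (t : R) (e : posreal) :
  J t -> locally t (fun y => J y /\ Rabs (p y - p t) < e).
Proof.
  intros [x [Ix ->]]; rewrite (sK x Ix).
  destruct (open_Rbar_interval lo hi x Ix) as [d Hd].
  (* Below [d], so that the segment of radius [r] stays in the interval; below [e], so that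
     preimages are close enough. Halving makes both bounds strict. *)
  set (r := Rmin d e / 2).
  assert (Hr : 0 < r /\ r < d /\ r < e).
  { generalize (Rmin_l d e) (Rmin_r d e) (cond_pos d) (cond_pos e).
    generalize (Rmin_pos d e (cond_pos d) (cond_pos e)); unfold r; lra. }
  assert (I1 : I (x - r)).
  { apply Hd; change (Rabs (x - r - x) < d).
    replace (x - r - x) with (- r) by ring.
    rewrite Rabs_Ropp, Rabs_right; lra. }
  assert (I2 : I (x + r)).
  { apply Hd; change (Rabs (x + r - x) < d).
    replace (x + r - x) with r by ring; rewrite Rabs_right; lra. }
  assert (H1 : s (x - r) < s x) by (apply s_increasing; auto; lra).
  assert (H2 : s x < s (x + r)) by (apply s_increasing; auto; lra).
  assert (Hw : 0 < Rmin (s x - s (x - r)) (s (x + r) - s x))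
    by (apply Rmin_pos; lra).
  exists (mkposreal _ Hw); intros y Hy.
  change (Rabs (y - s x) < Rmin (s x - s (x - r)) (s (x + r) - s x)) in Hy.
  generalize (Rmin_l (s x - s (x - r)) (s (x + r) - s x)).
  generalize (Rmin_r (s x - s (x - r)) (s (x + r) - s x)).
  intros M1 M2; apply Rabs_def2 in Hy.
  destruct (s_surjective (x - r) (x + r) y) as [z [Hz <-]]; auto; try lra.
  assert (Iz : I z)
    by (apply (convex_Rbar_interval lo hi (x - r) (x + r)); auto).
  split; [exists z; auto|].
  rewrite sK by auto; apply Rabs_def1; lra.
Qed.

Lemma image_open : open J.
Proof.
  intros t Jt; generalize (image_nbhd t (mkposreal 1 Rlt_0_1) Jt).
  apply filter_imp; tauto.
Qed.

(** The difference quotient of [p] for an increment [h] is the reciprocal of that of [s] for the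
    increment [k = p (t + h) - p t], and [k] tends to zero with [h] by continuity of [p]. *)
Lemma is_derive_inverse (t : R) : J t -> is_derive p t (/ s' (p t)).
Proof.
  intros Jt; destruct (image_in t Jt) as [Ix Ex].
  set (x := p t) in *.
  pose proof (s_derive x Ix) as Hs; apply is_derive_Reals in Hs.
  pose proof (s'_pos x Ix) as Hpos.
  apply is_derive_Reals; intros e He.
  set (q := fun h => / ((s (x + h) - s x) / h)).
  assert (Hq : exists d : posreal, forall h, h <> 0 -> Rabs h < d ->
    Rabs (q h - / s' x) < e).
  (* In filter form, the limit of the quotients of [s] can be composed with the continuity of [Rinv]
     at [s' x], which is positive. *)
  { assert (L : filterlim (fun h => (s (x + h) - s x) / h)
      (locally' 0) (locally (s' x))).
    { intros P [d HP]; destruct (Hs d (cond_pos d)) as [r Hr].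
      exists r; intros h Hh Nh; apply HP, Hr; auto.
      change (Rabs (h - 0) < r) in Hh; now rewrite Rminus_0_r in Hh. }
    assert (L' : filterlim q (locally' 0) (locally (/ s' x))).
    { apply (filterlim_comp _ _ _ _ Rinv _ _ _ L).
      apply (continuity_pt_filterlim Rinv (s' x)).
      apply (is_derive_continuity_pt _ _ (- 1 / s' x ^ 2)).
      apply (is_derive_inv (fun y => y)); [|lra].
      apply (is_derive_id (s' x)). }
    destruct (L' (fun y => Rabs (y - / s' x) < e)) as [d Hd].
    { exists (mkposreal e He); intros y Hy; exact Hy. }
    exists d; intros h Nh Hh; apply Hd; auto.
    change (Rabs (h - 0) < d); now rewrite Rminus_0_r. }
  destruct Hq as [d Hd].
  destruct (image_nbhd t d Jt) as [r Hr].
  exists r; intros h Nh Hh.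
  destruct (Hr (t + h)) as [Jh Bh].
  { change (Rabs (t + h - t) < r); now replace (t + h - t) with h by ring. }
  destruct (image_in _ Jh) as [Iy Ey].
  fold x in Bh |- *; set (k := p (t + h) - x) in *.
  assert (Ek : p (t + h) = x + k) by (unfold k; ring).
  (* Since [s] sends [x + k] to [t + h], the equality [k = 0] would force [h = 0]. *)
  assert (Nk : k <> 0).
  { intros E; rewrite Ek, E, Rplus_0_r in Ey; lra. }
  replace (k / h) with (q k); [apply Hd; auto|].
  unfold q; rewrite <- Ek, Ey, Ex; field; split; [auto|].
  replace (t + h - t) with h by ring; auto.
Qed.

End InverseFunction.

(** * Vector algebra and calculus *)

Lemma vec_ext (v w : vec) : vx v = vx w -> vy v = vy w -> vz v = vz w -> v = w.
Proof.
  destruct v as [[v1 v2] v3], w as [[w1 w2] w3]; cbn; congruence.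
Qed.

Ltac vec_ring :=
  match goal with
  | |- @eq R _ _ => idtac
  | |- _ => apply vec_ext
  end;
  unfold dot, cross, vx, vy, vz; cbn -[pow];
  unfold plus, scal, mult, opp, zero; cbn -[pow];
  unfold mult; cbn -[pow]; ring.

Lemma dot_comm (v w : vec) : dot v w = dot w v.
Proof. vec_ring. Qed.

Lemma dot_plus_l (u v w : vec) : dot (plus u v) w = dot u w + dot v w.
Proof. vec_ring. Qed.

Lemma dot_plus_r (u v w : vec) : dot u (plus v w) = dot u v + dot u w.
Proof. vec_ring. Qed.

Lemma dot_scal_l (k : R) (v w : vec) : dot (scal k v) w = k * dot v w.
Proof. vec_ring. Qed.

Lemma dot_scal_r (k : R) (v w : vec) : dot v (scal k w) = k * dot v w.
Proof. vec_ring. Qed.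

Lemma dot_cross_l (v w : vec) : dot v (cross v w) = 0.
Proof. vec_ring. Qed.

Lemma cross_cross (u v w : vec) :
  cross u (cross v w) = plus (scal (dot u w) v) (scal (- dot u v) w).
Proof. vec_ring. Qed.

Lemma dot_cross_cross (v w : vec) :
  dot (cross v w) (cross v w) = dot v v * dot w w - dot v w * dot v w.
Proof. vec_ring. Qed.

(** Expansion of [z] in the basis [v], [w], [cross v w] by means of the dual basis, multiplied by
    the determinant [|v x w|^2]. Without a division it is a polynomial identity, valid for all
    vectors. *)
Lemma scal_dot_cross (v w z : vec) :
  scal (dot (cross v w) (cross v w)) z =
  plus (plus (scal (dot z (cross w (cross v w))) v)
             (scal (dot z (cross (cross v w) v)) w))
       (scal (dot z (cross v w)) (cross v w)).
Proof. vec_ring. Qed.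

Lemma cross_scal_l (k : R) (v w : vec) : cross (scal k v) w = scal k (cross v w).
Proof. vec_ring. Qed.

Lemma cross_scal_r (k : R) (v w : vec) : cross v (scal k w) = scal k (cross v w).
Proof. vec_ring. Qed.

Lemma cross_plus_l (u v w : vec) :
  cross (plus u v) w = plus (cross u w) (cross v w).
Proof. vec_ring. Qed.

Lemma cross_plus_r (u v w : vec) :
  cross u (plus v w) = plus (cross u v) (cross u w).
Proof. vec_ring. Qed.

Lemma cross_self (v : vec) : cross v v = zero.
Proof. vec_ring. Qed.

Lemma scal_scal (k l : R) (v : vec) : scal k (scal l v) = scal (k * l) v.
Proof. vec_ring. Qed.

Lemma dot_pos (v : vec) : v <> zero -> 0 < dot v v.
Proof.
  intros H; unfold dot.
  destruct (Rlt_le_dec 0 (vx v * vx v + vy v * vy v + vz v * vz v)) as [|L];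
    [easy|elim H].
  apply vec_ext; cbn; unfold zero; cbn; nra.
Qed.

Lemma dot_self_nonneg (v : vec) : 0 <= dot v v.
Proof. unfold dot; nra. Qed.

Lemma vnorm_sqr (v : vec) : vnorm v * vnorm v = dot v v.
Proof. apply sqrt_sqrt, dot_self_nonneg. Qed.

Lemma vnorm_pos (v : vec) : v <> zero -> 0 < vnorm v.
Proof. intros H; apply sqrt_lt_R0, dot_pos, H. Qed.

Lemma vnorm_scal (k : R) (v : vec) : vnorm (scal k v) = Rabs k * vnorm v.
Proof.
  unfold vnorm; rewrite dot_scal_l, dot_scal_r, <- Rmult_assoc.
  rewrite sqrt_mult by (generalize (dot_self_nonneg v); nra).
  now rewrite <- sqrt_Rsqr_abs.
Qed.

Lemma vnorm_eq1 (v : vec) : vnorm v = 1 <-> dot v v = 1.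
Proof.
  split; intros H.
  - rewrite <- vnorm_sqr, H; ring.
  - unfold vnorm; rewrite H; apply sqrt_1.
Qed.

Lemma vnorm_neq0 (v : vec) : v <> zero <-> vnorm v <> 0.
Proof.
  split; intros H.
  - generalize (vnorm_pos v H); lra.
  - intros ->; apply H.
    unfold vnorm; replace (dot zero zero) with 0 by (symmetry; vec_ring).
    apply sqrt_0.
Qed.

(** For an orthonormal pair the determinant of the basis is 1 and the dual vectors are the basis
    vectors themselves. *)
Lemma orthonormal_expansion (v w z : vec) :
  dot v v = 1 -> dot w w = 1 -> dot v w = 0 ->
  z = plus (plus (scal (dot z v) v) (scal (dot z w) w))
           (scal (dot z (cross v w)) (cross v w)).
Proof.
  intros Hv Hw Hvw.
  replace (dot z v) with (dot z (cross w (cross v w))).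
  2: { rewrite cross_cross, dot_plus_r, !dot_scal_r, Hw, (dot_comm w v), Hvw.
       ring. }
  replace (dot z w) with (dot z (cross (cross v w) v)).
  2: { replace (cross (cross v w) v) with (scal (-1) (cross v (cross v w)))
         by vec_ring.
       rewrite cross_cross, dot_scal_r, dot_plus_r, !dot_scal_r, Hv, Hvw; ring. }
  rewrite <- scal_dot_cross, dot_cross_cross, Hv, Hw, Hvw.
  vec_ring.
Qed.

(** * Derivatives and smoothness of vector-valued functions *)

Definition is_vderive (f : R -> vec) (t : R) (l : vec) : Prop :=
  is_derive (fun x => vx (f x)) t (vx l) /\
  is_derive (fun x => vy (f x)) t (vy l) /\
  is_derive (fun x => vz (f x)) t (vz l).

Definition vsmooth (D : R -> Prop) (f : R -> vec) : Prop :=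
  smooth D (fun x => vx (f x)) /\
  smooth D (fun x => vy (f x)) /\
  smooth D (fun x => vz (f x)).

(** Leads from the relation, which asserts differentiability and follows the rules of calculus, to
    the total operator [vderive] that occurs in the Frenet apparatus. *)
Lemma is_vderive_unique (f : R -> vec) (t : R) (l : vec) :
  is_vderive f t l -> vderive f t = l.
Proof.
  intros (H1 & H2 & H3).
  apply vec_ext; apply is_derive_unique; assumption.
Qed.

Lemma is_vderive_plus (f g : R -> vec) (t : R) (f' g' : vec) :
  is_vderive f t f' -> is_vderive g t g' ->
  is_vderive (fun x => plus (f x) (g x)) t (plus f' g').
Proof.
  intros (F1 & F2 & F3) (G1 & G2 & G3); split; [|split].
  - exact (is_derive_plus _ _ t _ _ F1 G1).
  - exact (is_derive_plus _ _ t _ _ F2 G2).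
  - exact (is_derive_plus _ _ t _ _ F3 G3).
Qed.

Lemma is_vderive_scal_const (k : R) (f : R -> vec) (t : R) (f' : vec) :
  is_vderive f t f' -> is_vderive (fun x => scal k (f x)) t (scal k f').
Proof.
  intros (F1 & F2 & F3); split; [|split].
  - exact (is_derive_scal _ t k _ F1).
  - exact (is_derive_scal _ t k _ F2).
  - exact (is_derive_scal _ t k _ F3).
Qed.

Lemma is_vderive_comp (f : R -> vec) (p : R -> R) (t p' : R) (f' : vec) :
  is_vderive f (p t) f' -> is_derive p t p' ->
  is_vderive (fun x => f (p x)) t (scal p' f').
Proof.
  intros (F1 & F2 & F3) P; split; [|split].
  - exact (is_derive_Rcomp _ p t _ _ F1 P).
  - exact (is_derive_Rcomp _ p t _ _ F2 P).
  - exact (is_derive_Rcomp _ p t _ _ F3 P).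
Qed.

Lemma is_derive_dot (f g : R -> vec) (t : R) (f' g' : vec) :
  is_vderive f t f' -> is_vderive g t g' ->
  is_derive (fun x => dot (f x) (g x)) t (dot f' (g t) + dot (f t) g').
Proof.
  intros (F1 & F2 & F3) (G1 & G2 & G3).
  replace (dot f' (g t) + dot (f t) g') with
    (vx f' * vx (g t) + vx (f t) * vx g' + (vy f' * vy (g t) + vy (f t) * vy g') +
     (vz f' * vz (g t) + vz (f t) * vz g')) by (unfold dot; ring).
  apply (is_derive_plus (fun x => vx (f x) * vx (g x) + vy (f x) * vy (g x))).
  - apply (is_derive_plus (fun x => vx (f x) * vx (g x)));
      apply is_derive_Rmult; assumption.
  - apply is_derive_Rmult; assumption.
Qed.

Lemma is_vderive_cross (f g : R -> vec) (t : R) (f' g' : vec) :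
  is_vderive f t f' -> is_vderive g t g' ->
  is_vderive (fun x => cross (f x) (g x)) t
    (plus (cross f' (g t)) (cross (f t) g')).
Proof.
  intros (F1 & F2 & F3) (G1 & G2 & G3).
  assert (H : forall a b c d : R -> R, forall a' b' c' d',
    is_derive a t a' -> is_derive b t b' -> is_derive c t c' ->
    is_derive d t d' ->
    is_derive (fun x => a x * b x - c x * d x) t
      ((a' * b t - c' * d t) + (a t * b' - c t * d'))).
  { intros a b c d a' b' c' d' A B C E.
    replace ((a' * b t - c' * d t) + (a t * b' - c t * d')) with
      ((a' * b t + a t * b') - (c' * d t + c t * d')) by ring.
    apply (is_derive_minus (fun x => a x * b x) (fun x => c x * d x));
      apply is_derive_Rmult; assumption. }
  split; [|split]; apply H; assumption.
Qed.

Lemma is_vderive_ext_on (D : R -> Prop) (f g : R -> vec) (t : R) (l : vec) :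
  open D -> D t -> (forall x, D x -> f x = g x) ->
  is_vderive f t l -> is_vderive g t l.
Proof.
  intros Do Dt E (F1 & F2 & F3); split; [|split];
    [apply (is_derive_ext_on D Do (fun x => vx (f x)))
    |apply (is_derive_ext_on D Do (fun x => vy (f x)))
    |apply (is_derive_ext_on D Do (fun x => vz (f x)))]; auto;
    intros x Dx; now rewrite E.
Qed.

Section VSmooth.

Variable D : R -> Prop.
Hypothesis D_open : open D.

Lemma smooth_on_iff (f : R -> vec) : smooth_on D f <-> vsmooth D f.
Proof.
  unfold vsmooth; rewrite !(smooth_iff_ex_derive_n D D_open); split.
  - intros H; split; [|split]; intros n t Dt; apply (H n t Dt).
  - intros (H1 & H2 & H3) n t Dt; auto.
Qed.

Lemma vsmooth_is_vderive (f : R -> vec) (t : R) :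
  vsmooth D f -> D t -> is_vderive f t (vderive f t).
Proof.
  intros (H1 & H2 & H3) Dt; split; [|split]; apply (smooth_is_derive D); auto.
Qed.

Lemma vsmooth_vderive (f : R -> vec) : vsmooth D f -> vsmooth D (vderive f).
Proof.
  intros (H1 & H2 & H3); split; [|split]; apply smooth_Derive; auto.
Qed.

Lemma vsmooth_ext (f g : R -> vec) :
  (forall t, D t -> f t = g t) -> vsmooth D f -> vsmooth D g.
Proof.
  intros E (H1 & H2 & H3); split; [|split];
    [apply (smooth_ext D D_open (fun x => vx (f x)))
    |apply (smooth_ext D D_open (fun x => vy (f x)))
    |apply (smooth_ext D D_open (fun x => vz (f x)))]; auto;
    intros x Dx; now rewrite E.
Qed.

Lemma vsmooth_primitive (f f' : R -> vec) :
  (forall t, D t -> is_vderive f t (f' t)) -> vsmooth D f' -> vsmooth D f.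
Proof.
  intros E (H1 & H2 & H3); split; [|split];
    [apply (smooth_primitive D _ (fun x => vx (f' x)))
    |apply (smooth_primitive D _ (fun x => vy (f' x)))
    |apply (smooth_primitive D _ (fun x => vz (f' x)))]; auto;
    intros t Dt; apply (E t Dt).
Qed.

Lemma vsmooth_plus (f g : R -> vec) :
  vsmooth D f -> vsmooth D g -> vsmooth D (fun t => plus (f t) (g t)).
Proof.
  intros (F1 & F2 & F3) (G1 & G2 & G3); split; [|split].
  - exact (smooth_plus D _ _ F1 G1).
  - exact (smooth_plus D _ _ F2 G2).
  - exact (smooth_plus D _ _ F3 G3).
Qed.

Lemma vsmooth_scal (k : R -> R) (f : R -> vec) :
  smooth D k -> vsmooth D f -> vsmooth D (fun t => scal (k t) (f t)).
Proof.
  intros K (F1 & F2 & F3); split; [|split].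
  - exact (smooth_mult D _ _ K F1).
  - exact (smooth_mult D _ _ K F2).
  - exact (smooth_mult D _ _ K F3).
Qed.

Lemma vsmooth_scal_const (k : R) (f : R -> vec) :
  vsmooth D f -> vsmooth D (fun t => scal k (f t)).
Proof. apply vsmooth_scal, smooth_const. Qed.

Lemma smooth_dot (f g : R -> vec) :
  vsmooth D f -> vsmooth D g -> smooth D (fun t => dot (f t) (g t)).
Proof.
  intros (F1 & F2 & F3) (G1 & G2 & G3).
  repeat apply smooth_plus; apply smooth_mult; assumption.
Qed.

Lemma vsmooth_cross (f g : R -> vec) :
  vsmooth D f -> vsmooth D g -> vsmooth D (fun t => cross (f t) (g t)).
Proof.
  intros (F1 & F2 & F3) (G1 & G2 & G3).
  split; [|split]; apply (smooth_minus D D_open); apply smooth_mult; assumption.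
Qed.

Lemma smooth_vnorm (f : R -> vec) :
  (forall t, D t -> f t <> zero) -> vsmooth D f ->
  smooth D (fun t => vnorm (f t)).
Proof.
  intros Nf F; apply smooth_sqrt.
  - intros t Dt; apply dot_pos; auto.
  - apply smooth_dot; auto.
Qed.

Lemma vsmooth_normalize (f : R -> vec) :
  (forall t, D t -> f t <> zero) -> vsmooth D f ->
  vsmooth D (fun t => scal (/ vnorm (f t)) (f t)).
Proof.
  intros Nf F; apply vsmooth_scal; [|easy].
  apply smooth_inv; [|apply smooth_vnorm; auto].
  intros t Dt; apply vnorm_neq0; auto.
Qed.

(** Applied to the orthonormality relations of a frame, this gives the skew-symmetry of its
    structure equations. *)
Lemma dot_vderive_const (f g : R -> vec) (k t : R) (f' g' : vec) :
  D t -> (forall x, D x -> dot (f x) (g x) = k) ->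
  is_vderive f t f' -> is_vderive g t g' -> dot f' (g t) + dot (f t) g' = 0.
Proof.
  intros Dt E F G.
  pose proof (is_derive_dot f g t f' g' F G) as H.
  rewrite <- (is_derive_unique _ _ _ H).
  apply is_derive_unique, (is_derive_ext_on D D_open (fun _ => k)); auto.
  - intros x Dx; symmetry; auto.
  - exact (is_derive_const k t).
Qed.

End VSmooth.

Lemma vsmooth_comp (I J : R -> Prop) (f : R -> vec) (p : R -> R) :
  (forall t, J t -> I (p t)) ->
  vsmooth I f -> smooth J p -> vsmooth J (fun t => f (p t)).
Proof.
  intros JI (F1 & F2 & F3) P; split; [|split].
  - exact (smooth_comp I J _ p JI F1 P).
  - exact (smooth_comp I J _ p JI F2 P).
  - exact (smooth_comp I J _ p JI F3 P).
Qed.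

(** * Moving frames of spherical curves *)

(* Up to signs, [U] is the unit tangent of the spherical curve [N], [w] its
   speed and [g / w] its geodesic curvature. *)
Record spherical_frame (D : R -> Prop) (N U C : R -> vec) (w g : R -> R) : Prop := {
  frame_NN : forall t, D t -> dot (N t) (N t) = 1;
  frame_UU : forall t, D t -> dot (U t) (U t) = 1;
  frame_NU : forall t, D t -> dot (N t) (U t) = 0;
  frame_C : forall t, D t -> C t = cross (N t) (U t);
  frame_dN : forall t, D t -> is_vderive N t (scal (w t) (U t));
  frame_dU : forall t, D t ->
    is_vderive U t (plus (scal (- w t) (N t)) (scal (- g t) (C t)));
  frame_dC : forall t, D t -> is_vderive C t (scal (g t) (U t));
  frame_smooth_N : vsmooth D N;
  frame_smooth_U : vsmooth D U;
  frame_smooth_C : vsmooth D C;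
  frame_smooth_w : smooth D w;
  frame_smooth_g : smooth D g
}.

Arguments frame_NN {D N U C w g}.
Arguments frame_UU {D N U C w g}.
Arguments frame_NU {D N U C w g}.
Arguments frame_C {D N U C w g}.
Arguments frame_dN {D N U C w g}.
Arguments frame_dU {D N U C w g}.
Arguments frame_dC {D N U C w g}.

Lemma scal_unit_neq_zero (k : R) (v : vec) :
  dot v v = 1 -> k <> 0 -> scal k v <> zero.
Proof.
  intros Hv Hk E; apply Hk.
  assert (H : dot (scal k v) (scal k v) = 0) by (rewrite E; vec_ring).
  rewrite dot_scal_l, dot_scal_r, Hv in H; nra.
Qed.

Section Frame.

Variables (D : R -> Prop) (N U C : R -> vec) (w g : R -> R).
Hypothesis F : spherical_frame D N U C w g.

Lemma frame_CC t : D t -> dot (C t) (C t) = 1.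
Proof.
  intros Dt; rewrite (frame_C F t Dt), dot_cross_cross.
  rewrite (frame_NN F t Dt), (frame_UU F t Dt),
    (frame_NU F t Dt); ring.
Qed.

Lemma frame_CN t : D t -> dot (C t) (N t) = 0.
Proof.
  intros Dt; now rewrite (frame_C F t Dt), dot_comm, dot_cross_l.
Qed.

Lemma frame_CxU t : D t -> cross (C t) (U t) = scal (-1) (N t).
Proof.
  intros Dt; rewrite (frame_C F t Dt).
  replace (cross (cross (N t) (U t)) (U t)) with
    (scal (-1) (cross (U t) (cross (N t) (U t)))) by vec_ring.
  rewrite cross_cross, (frame_UU F t Dt), (dot_comm (U t)).
  rewrite (frame_NU F t Dt); vec_ring.
Qed.

(** [C] and [N] both move along [U], hence so does each of their combinations with constant
    coefficients. The tangent of [gamma] is one of these, which is why its principal normal lies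
    along [U]. *)
Lemma frame_combination (x y t : R) :
  D t ->
  is_vderive (fun u => plus (scal x (C u)) (scal y (N u))) t
    (scal (x * g t + y * w t) (U t)).
Proof.
  intros Dt.
  replace (scal (x * g t + y * w t) (U t)) with
    (plus (scal x (scal (g t) (U t))) (scal y (scal (w t) (U t))))
    by vec_ring.
  apply is_vderive_plus; apply is_vderive_scal_const.
  - exact (frame_dC F t Dt).
  - exact (frame_dN F t Dt).
Qed.

Lemma frame_combination_norm (x y t : R) :
  D t -> vnorm (plus (scal x (C t)) (scal y (N t))) = sqrt (x * x + y * y).
Proof.
  intros Dt; unfold vnorm; f_equal.
  rewrite !dot_plus_l, !dot_plus_r, !dot_scal_l, !dot_scal_r.
  rewrite (dot_comm (N t) (C t)), frame_CC, frame_CN,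
    (frame_NN F t) by easy; ring.
Qed.

End Frame.

Arguments frame_CC {D N U C w g}.
Arguments frame_CN {D N U C w g}.
Arguments frame_CxU {D N U C w g}.
Arguments frame_combination {D N U C w g}.
Arguments frame_combination_norm {D N U C w g}.

(** Sliding the base point along a line and rescaling its direction do not change it. With [v] equal
    to [U], this is the normal line common to [gamma] and its mate. *)
Lemma line_scal (p v v' q : vec) (l k k' : R) :
  k <> 0 -> k' <> 0 ->
  line (plus p (scal l v)) (scal k v) q <-> line p (scal k' v) q.
Proof.
  intros Hk Hk'; split; intros [r ->].
  - exists ((l + r * k) / k').
    replace (scal ((l + r * k) / k') (scal k' v)) with (scal (l + r * k) v).
    + vec_ring.
    + rewrite scal_scal; f_equal; field; auto.
  - exists ((r * k' - l) / k).
    replace (scal ((r * k' - l) / k) (scal k v)) with (scal (r * k' - l) v).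
    + vec_ring.
    + rewrite scal_scal; f_equal; field; auto.
Qed.

Lemma plus_scal_neq (p v : vec) (l : R) :
  dot v v = 1 -> l <> 0 -> plus p (scal l v) <> p.
Proof.
  intros Hv Hl E; apply (scal_unit_neq_zero l v Hv Hl).
  replace (scal l v) with (plus (plus p (scal l v)) (scal (-1) p)) by vec_ring.
  rewrite E; vec_ring.
Qed.

(** * The Bertrand property *)

Section Bertrand.

Variables (D : R -> Prop) (N U C gamma : R -> vec) (f : R -> R) (e a k t0 : R).
Hypothesis D_open : open D.
Hypothesis D_convex : convex D.
Hypothesis D_t0 : D t0.
Hypothesis e_sign : e = 1 \/ e = -1.
Hypothesis F : spherical_frame D N U C f (fun _ => e).
Hypothesis f_pos : forall t, D t -> 0 < f t.
Hypothesis gamma_derive : forall t, D t ->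
  is_vderive gamma t (plus (scal a (C t)) (scal (a * k) (N t))).
Hypothesis gamma_regular : regular_on D gamma.
Hypothesis gamma_curved : curved_on D gamma.

Let L := sqrt (a * a + (a * k) * (a * k)).
(** A signed version of the curvature: the tangent has derivative [h U], so the curvature of [gamma]
    is [|h| / L]. *)
Let h := fun t => a / L * (e + k * f t).

Lemma gamma_vderive t :
  D t -> vderive gamma t = plus (scal a (C t)) (scal (a * k) (N t)).
Proof. intros Dt; apply is_vderive_unique; auto. Qed.

Lemma gamma_speed t : D t -> vnorm (vderive gamma t) = L.
Proof.
  intros Dt; rewrite gamma_vderive by easy.
  apply (frame_combination_norm F); auto.
Qed.

Lemma gamma_speed_pos : 0 < L.
Proof. rewrite <- (gamma_speed t0 D_t0); apply vnorm_pos; auto. Qed.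

(** Regularity of [gamma] enters here: [a = 0] would make the speed [L] vanish. *)
Lemma gamma_coef_neq0 : a <> 0.
Proof.
  intros E; generalize gamma_speed_pos; unfold L; rewrite E.
  replace (0 * 0 + 0 * k * (0 * k)) with 0 by ring.
  rewrite sqrt_0; lra.
Qed.

Lemma gamma_speed_sqr : L * L = a * a * (1 + k * k).
Proof. unfold L; rewrite sqrt_sqrt; nra. Qed.

Lemma gamma_tangent t :
  D t -> tangent gamma t = plus (scal (a / L) (C t)) (scal (a / L * k) (N t)).
Proof.
  intros Dt; unfold tangent.
  rewrite gamma_speed, gamma_vderive by easy; unfold Rdiv; vec_ring.
Qed.

Lemma gamma_dtangent t :
  D t -> vderive (tangent gamma) t = scal (h t) (U t).
Proof.
  intros Dt; apply is_vderive_unique.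
  apply (is_vderive_ext_on D
    (fun x => plus (scal (a / L) (C x)) (scal (a / L * k) (N x)))); auto.
  - intros x Dx; symmetry; apply gamma_tangent, Dx.
  - replace (h t) with (a / L * e + a / L * k * f t) by (unfold h; ring).
    apply (frame_combination F); auto.
Qed.

Lemma gamma_dtangent_norm t :
  D t -> vnorm (vderive (tangent gamma) t) = Rabs (h t).
Proof.
  intros Dt; rewrite gamma_dtangent, vnorm_scal by easy.
  replace (vnorm (U t)) with 1; [ring|].
  symmetry; apply vnorm_eq1, F, Dt.
Qed.

Lemma gamma_h_neq0 t : D t -> h t <> 0.
Proof.
  intros Dt E; apply (gamma_curved t Dt); unfold curvature.
  rewrite gamma_dtangent_norm, E, Rabs_R0 by easy; unfold Rdiv; ring.
Qed.

(** Non-vanishing curvature keeps the continuous function [h] away from zero. One sign then serves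
    the whole domain, so that the normal is a fixed multiple of [U] and can be differentiated. *)
Lemma gamma_h_sign :
  exists eta, (eta = 1 \/ eta = -1) /\ forall t, D t -> Rabs (h t) = eta * h t.
Proof.
  destruct (constant_sign D h t0) as [eta [He H]]; auto.
  - intros t Dt; apply (smooth_continuity_pt D); auto.
    apply smooth_mult; [apply smooth_const|].
    apply smooth_plus; [apply smooth_const|].
    apply smooth_mult; [apply smooth_const|apply F].
  - exact gamma_h_neq0.
  - exists eta; split; [easy|]; intros t Dt; specialize (H t Dt).
    destruct He as [-> | ->].
    + rewrite Rabs_right; lra.
    + rewrite Rabs_left; lra.
Qed.

Lemma gamma_normal eta :
  (eta = 1 \/ eta = -1) -> (forall t, D t -> Rabs (h t) = eta * h t) ->
  forall t, D t -> normal gamma t = scal eta (U t).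
Proof.
  intros He Hh t Dt; unfold normal.
  rewrite gamma_dtangent_norm, gamma_dtangent, Hh, scal_scal by easy.
  f_equal; generalize (gamma_h_neq0 t Dt); intros Nh.
  destruct He as [-> | ->]; field; auto.
Qed.

(** The sign [eta] enters both through the derivative of the normal and through the binormal, and
    cancels as [eta * eta = 1]. *)
Lemma gamma_torsion t : D t -> torsion gamma t = a / L * (f t - e * k) / L.
Proof.
  intros Dt; destruct gamma_h_sign as [eta [He Hh]].
  unfold torsion; rewrite gamma_speed by easy; f_equal.
  replace (vderive (normal gamma) t) with
    (scal eta (plus (scal (- f t) (N t)) (scal (- e) (C t)))).
  2: { symmetry; apply is_vderive_unique.
       apply (is_vderive_ext_on D (fun x => scal eta (U x))); auto.
       - intros x Dx; symmetry; apply gamma_normal; auto.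
       - apply is_vderive_scal_const, (frame_dU F t Dt). }
  unfold binormal; rewrite gamma_tangent, (gamma_normal eta) by easy.
  rewrite cross_plus_l, !cross_scal_l, !cross_scal_r.
  rewrite (frame_CxU F) by easy.
  rewrite <- (frame_C F t Dt).
  rewrite !dot_scal_l, !dot_plus_l, !dot_plus_r, !dot_scal_l, !dot_scal_r.
  rewrite (dot_comm (N t) (C t)), (frame_CC F),
    (frame_CN F), (frame_NN F t) by easy.
  destruct He as [-> | ->]; ring.
Qed.

(** The coefficients are chosen to eliminate [f] between curvature and torsion. That of the torsion
    contains the factor [k], whence the assumption [k <> 0]. *)
Lemma gamma_bertrand_relation : k <> 0 -> bertrand_relation D gamma.
Proof.
  intros Hk; destruct gamma_h_sign as [eta [He Hh]].
  pose proof gamma_coef_neq0 as Ha; pose proof gamma_speed_pos as HL.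
  exists (eta * (e * a)), (- k * (e * a)).
  assert (He0 : e <> 0) by (destruct e_sign; lra).
  assert (Heta0 : eta <> 0) by (destruct He; lra).
  split; [|split].
  - repeat apply Rmult_integral_contrapositive_currified; auto.
  - repeat apply Rmult_integral_contrapositive_currified; auto; lra.
  - intros t Dt; unfold curvature.
    rewrite gamma_torsion, gamma_dtangent_norm, gamma_speed, Hh by easy.
    assert (E1 : eta * eta = 1) by (destruct He; subst; ring).
    assert (E2 : e * e = 1) by (destruct e_sign; subst; ring).
    unfold h.
    (* The squares of [eta] are kept visible: replacing them by 1 removes the [f] term and leaves
       [e * e * a * a * (1 + k * k) / (L * L)], which is [e * e]. *)
    transitivity ((e * a * a * (eta * eta * e + (eta * eta - 1) * k * f t
      + k * k * e)) / (L * L)); [field; lra|].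
    rewrite gamma_speed_sqr, E1.
    transitivity (e * e); [field; split; [nra|easy]|easy].
Qed.

Lemma gamma_smooth : vsmooth D gamma.
Proof.
  apply (vsmooth_primitive D gamma _ gamma_derive).
  apply vsmooth_plus; apply vsmooth_scal_const; apply F.
Qed.

(** Candidates for a mate are the offsets along [U]. Because [e * e = 1], the choice [l = e * a]
    cancels the [C] component of the velocity, while [l = - (e * a)] doubles it. *)
Lemma gamma_shift_derive (l : R) t :
  D t -> is_vderive (fun x => plus (gamma x) (scal l (U x))) t
    (plus (scal (a - l * e) (C t)) (scal (a * k - l * f t) (N t))).
Proof.
  intros Dt.
  replace (plus (scal (a - l * e) (C t)) (scal (a * k - l * f t) (N t))) with
    (plus (plus (scal a (C t)) (scal (a * k) (N t)))
       (scal l (plus (scal (- f t) (N t)) (scal (- e) (C t))))) by vec_ring.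
  apply is_vderive_plus; [auto|].
  apply is_vderive_scal_const, (frame_dU F t Dt).
Qed.

(** It is enough to find a unit field [u] along the velocity of the offset curve whose derivative is
    along [U]. The factor [r] is a signed speed, and its zeros are the singular points. *)
Lemma gamma_shift_mate (l : R) (u : R -> vec) (r d : R -> R) :
  l <> 0 -> vsmooth D u ->
  (forall t, D t -> dot (u t) (u t) = 1) ->
  (forall t, D t -> is_vderive u t (scal (d t) (U t)) /\ d t <> 0) ->
  (forall t, D t -> vderive (fun x => plus (gamma x) (scal l (U x))) t
    = scal (r t) (u t)) ->
  (forall t, D t -> r t = 0 ->
    torsion gamma t = 0 /\ exists t', D t' /\ torsion gamma t' <> 0) ->
  bertrand_mate D gamma (fun t => plus (gamma t) (scal l (U t))).
Proof.
  intros Hl Su Hu Hd Hr H0.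
  destruct gamma_h_sign as [eta [He Hh]].
  split; [|split; [|split; [|exists u; split]]].
  - apply smooth_on_iff; auto.
    apply vsmooth_plus; [apply gamma_smooth|].
    apply vsmooth_scal_const, F.
  - intros t Dt; apply plus_scal_neq; auto; apply F, Dt.
  - intros t Dt E; apply H0; auto.
    destruct (Req_dec (r t) 0) as [|Nr]; [easy|].
    rewrite Hr in E by easy; elim (scal_unit_neq_zero (r t) (u t)); auto.
  - apply smooth_on_iff; auto.
  - intros t Dt; destruct (Hd t Dt) as [D1 D2].
    rewrite (is_vderive_unique _ _ _ D1), (gamma_normal eta) by easy.
    split; [apply vnorm_eq1; auto|split; [exists (r t); auto|split]].
    + apply scal_unit_neq_zero; [apply F, Dt|easy].
    + intros q; apply line_scal; auto; destruct He; lra.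
Qed.

Lemma gamma_has_mate : exists b, bertrand_mate D gamma b.
Proof.
  pose proof gamma_coef_neq0 as Ha; pose proof gamma_speed_pos as HL.
  assert (He0 : e <> 0) by (destruct e_sign; lra).
  assert (E2 : e * e = 1) by (destruct e_sign; subst; ring).
  assert (Hea : e * a <> 0) by (apply Rmult_integral_contrapositive_currified; auto).
  (* By the torsion formula, this separates the curves with torsion somewhere non-zero from the
     planar ones. *)
  destruct (classic (exists t', D t' /\ f t' <> e * k)) as [[t' [Dt' Ht']]|H].
  - exists (fun t => plus (gamma t) (scal (e * a) (U t))).
    apply (gamma_shift_mate _ N (fun t => a * k - e * a * f t) f); auto.
    + apply F.
    + apply F.
    + intros t Dt; split; [apply F, Dt|generalize (f_pos t Dt); lra].
    + intros t Dt.
      rewrite (is_vderive_unique _ _ _ (gamma_shift_derive (e * a) t Dt)).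
      replace (a - e * a * e) with (a * (1 - e * e)) by ring.
      rewrite E2; vec_ring.
    (* As [e * e = 1], the signed speed equals [- (e * a) * (f t - e * k)]. It vanishes only where
       the torsion does, and [t'] is a point of non-zero torsion. *)
    + intros t Dt E; split; [|exists t'; split; [easy|]].
      * rewrite gamma_torsion by easy.
        replace (f t - e * k) with 0; [field; lra|].
        apply (Rmult_eq_reg_l (e * a)); [|easy].
        transitivity ((1 - e * e) * (a * k) - (a * k - e * a * f t)); [|ring].
        rewrite E, E2; ring.
      * rewrite gamma_torsion by easy; unfold Rdiv.
        repeat apply Rmult_integral_contrapositive_currified; auto;
          try apply Rinv_neq_0_compat; lra.
  - assert (Hf : forall t, D t -> f t = e * k).
    { intros t Dt; apply NNPP; intros E; apply H; exists t; auto. }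
    (* With [f = e * k] the offset by [e * a] has zero velocity: it is the centre of a circle
       carrying [gamma]. The opposite offset doubles the radius; its velocity is twice that of
       [gamma], so it keeps the tangent of [gamma] and has speed [2 * L]. *)
    exists (fun t => plus (gamma t) (scal (- (e * a)) (U t))).
    apply (gamma_shift_mate _
      (fun t => plus (scal (a / L) (C t)) (scal (a / L * k) (N t)))
      (fun _ => 2 * L) h).
    + lra.
    + apply vsmooth_plus; apply vsmooth_scal_const; apply F.
    + intros t Dt; apply vnorm_eq1.
      rewrite <- gamma_tangent by easy; unfold tangent.
      rewrite vnorm_scal, gamma_speed by easy.
      rewrite Rabs_right; [field; lra|].
      apply Rle_ge, Rlt_le, Rinv_0_lt_compat, HL.
    + intros t Dt; split; [|apply gamma_h_neq0, Dt].
      replace (h t) with (a / L * e + a / L * k * f t) by (unfold h; ring).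
      apply (frame_combination F); auto.
    + intros t Dt.
      rewrite (is_vderive_unique _ _ _ (gamma_shift_derive (- (e * a)) t Dt)).
      rewrite (Hf t Dt).
      replace (a - - (e * a) * e) with (2 * L * (a / L))
        by (transitivity (a * (1 + e * e)); [rewrite E2; field; lra|ring]).
      replace (a * k - - (e * a) * (e * k)) with (2 * L * (a / L * k))
        by (transitivity (a * k * (1 + e * e)); [rewrite E2; field; lra|ring]).
      vec_ring.
    + intros t Dt E; lra.
Qed.

Lemma gamma_bertrand_curve : bertrand_curve D gamma.
Proof.
  split; [|split; [|split]]; auto.
  - apply smooth_on_iff; auto; exact gamma_smooth.
  - exact gamma_has_mate.
Qed.

End Bertrand.

(** * Construction and reparametrization of spherical frames *)

Lemma spherical_frame_of_curve (D : R -> Prop) (N C : R -> vec) :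
  open D -> vsmooth D N -> (forall t, D t -> dot (N t) (N t) = 1) ->
  (forall t, D t -> vderive N t <> zero) ->
  (forall t, D t ->
    C t = cross (N t) (scal (/ vnorm (vderive N t)) (vderive N t))) ->
  exists U w g, spherical_frame D N U C w g /\ forall t, D t -> 0 < w t.
Proof.
  intros Do SN NN N0 HC.
  set (w := fun t => vnorm (vderive N t)).
  set (U := (fun t => scal (/ w t) (vderive N t)) : R -> vec).
  (* The value dictated by the [C] component of the equation for [U']. *)
  set (g := fun t => -1 * dot (vderive U t) (C t)).
  assert (w_pos : forall t, D t -> 0 < w t)
    by (intros t Dt; apply vnorm_pos; auto).
  pose proof (vsmooth_vderive D Do N SN) as SN'.
  assert (SU : vsmooth D U) by (apply vsmooth_normalize; auto).
  assert (SC : vsmooth D C).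
  { apply (vsmooth_ext D Do (fun t => cross (N t) (U t))).
    - intros t Dt; symmetry; apply HC, Dt.
    - apply vsmooth_cross; auto. }
  assert (UU : forall t, D t -> dot (U t) (U t) = 1).
  { intros t Dt; unfold U; rewrite dot_scal_l, dot_scal_r, <- vnorm_sqr.
    fold (w t); field; generalize (w_pos t Dt); lra. }
  assert (dN : forall t, D t -> is_vderive N t (scal (w t) (U t))).
  { intros t Dt; unfold U; rewrite scal_scal.
    replace (w t * / w t) with 1
      by (field; generalize (w_pos t Dt); lra).
    replace (scal 1 (vderive N t)) with (vderive N t) by vec_ring.
    apply (vsmooth_is_vderive D); auto. }
  assert (NU : forall t, D t -> dot (N t) (U t) = 0).
  { intros t Dt.
    pose proof (dot_vderive_const D Do N N 1 t _ _ Dt NN (dN t Dt) (dN t Dt)) as E.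
    rewrite dot_scal_l, dot_scal_r, (dot_comm (U t)) in E.
    apply (Rmult_eq_reg_l (w t)); generalize (w_pos t Dt); lra. }
  (* Expansion of [U'] in [N], [U], [C]: differentiating [dot U U = 1] and [dot N U = 0] gives the
     components 0 along [U] and [- w] along [N]. *)
  assert (dU : forall t, D t ->
    is_vderive U t (plus (scal (- w t) (N t)) (scal (- g t) (C t)))).
  { intros t Dt.
    pose proof (vsmooth_is_vderive D U t SU Dt) as H.
    pose proof (dot_vderive_const D Do U U 1 t _ _ Dt UU H H) as E1.
    pose proof (dot_vderive_const D Do N U 0 t _ _ Dt NU (dN t Dt) H) as E2.
    rewrite (dot_comm (U t)) in E1.
    rewrite dot_scal_l, UU, (dot_comm (N t)) in E2 by easy.
    replace (plus (scal (- w t) (N t)) (scal (- g t) (C t))) with (vderive U t);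
      [exact H|].
    rewrite (orthonormal_expansion (N t) (U t) (vderive U t)) by auto.
    change (scal (/ w t) (vderive N t)) with (U t) in HC.
    replace (cross (N t) (U t)) with (C t) by (apply HC, Dt).
    replace (dot (vderive U t) (N t)) with (- w t) by lra.
    replace (dot (vderive U t) (U t)) with 0 by lra.
    unfold g; vec_ring. }
  (* In the derivative of [N x U] only [- g (N x C)] survives, and [N x (N x U) = - U]. *)
  assert (dC : forall t, D t -> is_vderive C t (scal (g t) (U t))).
  { intros t Dt.
    apply (is_vderive_ext_on D (fun x => cross (N x) (U x))); auto.
    - intros x Dx; symmetry; apply HC, Dx.
    - replace (scal (g t) (U t)) with
        (plus (cross (scal (w t) (U t)) (U t))
          (cross (N t) (plus (scal (- w t) (N t)) (scal (- g t) (C t))))).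
      + apply is_vderive_cross; auto.
      + rewrite cross_scal_l, cross_self, cross_plus_r, !cross_scal_r, cross_self.
        replace (C t) with (cross (N t) (U t)) by (symmetry; apply HC, Dt).
        rewrite cross_cross, NN, NU by easy; vec_ring. }
  exists U, w, g; split; [split|]; auto.
  - apply smooth_vnorm; auto.
  - apply smooth_mult; [apply smooth_const|apply smooth_dot; auto].
    apply vsmooth_vderive; auto.
Qed.

(** By the chain rule both coefficients are multiplied by [p']. They are prescribed up to equality
    on [J], which allows [g1] to be written as a constant when the new parameter is an arc length of
    [C]. *)
Lemma spherical_frame_comp (I J : R -> Prop) (N U C : R -> vec)
  (w g p p' w1 g1 : R -> R) :
  open J -> (forall t, J t -> I (p t)) ->
  (forall t, J t -> is_derive p t (p' t)) -> smooth J p' ->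
  (forall t, J t -> w1 t = p' t * w (p t)) ->
  (forall t, J t -> g1 t = p' t * g (p t)) ->
  spherical_frame I N U C w g ->
  spherical_frame J (fun t => N (p t)) (fun t => U (p t)) (fun t => C (p t)) w1 g1.
Proof.
  intros Jo JI P Sp' W G F.
  pose proof (smooth_primitive J p p' P Sp') as Sp.
  destruct F; split; auto; try (apply (vsmooth_comp I); assumption);
    try (intros t Jt).
  - rewrite W, <- scal_scal by easy; apply is_vderive_comp; auto.
  - rewrite W, G by easy.
    replace (plus (scal (- (p' t * w (p t))) (N (p t)))
               (scal (- (p' t * g (p t))) (C (p t)))) with
      (scal (p' t) (plus (scal (- w (p t)) (N (p t)))
                      (scal (- g (p t)) (C (p t))))) by vec_ring.
    apply is_vderive_comp; auto.
  - rewrite G, <- scal_scal by easy; apply is_vderive_comp; auto.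
  - apply (smooth_ext J Jo (fun t => p' t * w (p t))).
    + intros t Jt; symmetry; auto.
    + apply smooth_mult; [|apply (smooth_comp I)]; auto.
  - apply (smooth_ext J Jo (fun t => p' t * g (p t))).
    + intros t Jt; symmetry; auto.
    + apply smooth_mult; [|apply (smooth_comp I)]; auto.
Qed.

(** * The Darboux vector of a unit speed curve *)

Section Frenet.

Variables (D : R -> Prop) (alpha : R -> vec).
Hypothesis D_open : open D.
Hypothesis alpha_smooth : vsmooth D alpha.
Hypothesis alpha_unit : forall t, D t -> vnorm (vderive alpha t) = 1.
Hypothesis alpha_curved : curved_on D alpha.

Let T := tangent alpha.
Let N := normal alpha.

Lemma unit_speed_tangent t : D t -> T t = vderive alpha t.
Proof.
  intros Dt; unfold T, tangent; rewrite alpha_unit, Rinv_1 by easy; vec_ring.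
Qed.

Lemma unit_speed_curvature t : D t -> curvature alpha t = vnorm (vderive T t).
Proof.
  intros Dt; unfold curvature; rewrite alpha_unit by easy; unfold T; field.
Qed.

Lemma unit_speed_dtangent_neq0 t : D t -> vderive T t <> zero.
Proof.
  intros Dt; apply vnorm_neq0; rewrite <- unit_speed_curvature; auto.
Qed.

Lemma tangent_smooth : vsmooth D T.
Proof.
  apply (vsmooth_ext D D_open (vderive alpha)).
  - intros t Dt; symmetry; apply unit_speed_tangent, Dt.
  - apply vsmooth_vderive; auto.
Qed.

Lemma normal_smooth : vsmooth D N.
Proof.
  apply vsmooth_normalize; auto.
  - exact unit_speed_dtangent_neq0.
  - apply vsmooth_vderive; auto; exact tangent_smooth.
Qed.

Lemma tangent_unit t : D t -> dot (T t) (T t) = 1.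
Proof.
  intros Dt; rewrite unit_speed_tangent by easy; apply vnorm_eq1; auto.
Qed.

Lemma dtangent_eq t : D t -> vderive T t = scal (curvature alpha t) (N t).
Proof.
  intros Dt; unfold N, normal; fold T.
  rewrite scal_scal, unit_speed_curvature by easy.
  replace (vnorm (vderive T t) * / vnorm (vderive T t)) with 1; [vec_ring|].
  field; apply vnorm_neq0, unit_speed_dtangent_neq0, Dt.
Qed.

Lemma normal_unit t : D t -> dot (N t) (N t) = 1.
Proof.
  intros Dt; unfold N, normal; fold T.
  rewrite dot_scal_l, dot_scal_r, <- vnorm_sqr.
  field; apply vnorm_neq0, unit_speed_dtangent_neq0, Dt.
Qed.

Lemma tangent_normal t : D t -> dot (T t) (N t) = 0.
Proof.
  intros Dt.
  pose proof (vsmooth_is_vderive D T t tangent_smooth Dt) as H.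
  pose proof (dot_vderive_const D D_open T T 1 t _ _ Dt tangent_unit H H) as E.
  rewrite dtangent_eq, dot_scal_l, dot_scal_r, (dot_comm (N t)) in E by easy.
  apply (Rmult_eq_reg_l (curvature alpha t)); [lra|apply alpha_curved, Dt].
Qed.

Lemma dnormal_tangent t :
  D t -> dot (vderive N t) (T t) = - curvature alpha t.
Proof.
  intros Dt.
  pose proof (vsmooth_is_vderive D T t tangent_smooth Dt) as H1.
  pose proof (vsmooth_is_vderive D N t normal_smooth Dt) as H2.
  pose proof (dot_vderive_const D D_open T N 0 t _ _ Dt tangent_normal H1 H2) as E.
  rewrite dtangent_eq, dot_scal_l, normal_unit, (dot_comm (T t)) in E by easy.
  lra.
Qed.

Lemma dnormal_normal t : D t -> dot (vderive N t) (N t) = 0.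
Proof.
  intros Dt.
  pose proof (vsmooth_is_vderive D N t normal_smooth Dt) as H.
  pose proof (dot_vderive_const D D_open N N 1 t _ _ Dt normal_unit H H) as E.
  rewrite (dot_comm (N t)) in E; lra.
Qed.

(** The [T] component of [N'] is minus the curvature. Thus [N] is a regular spherical curve, as the
    frame construction requires. *)
Lemma dnormal_neq0 t : D t -> vderive N t <> zero.
Proof.
  intros Dt E; apply (alpha_curved t Dt).
  pose proof (dnormal_tangent t Dt) as H; rewrite E in H.
  replace (dot zero (T t)) with 0 in H by (symmetry; vec_ring); lra.
Qed.

(** Insert the Frenet expansion of [N'] and use [N x T = - B] and [N x B = T]. The Darboux vector is
    thereby determined by the spherical curve [N] alone. *)
Lemma darboux_eq t : D t -> darboux alpha t = cross (N t) (vderive N t).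
Proof.
  intros Dt.
  rewrite (orthonormal_expansion (T t) (N t) (vderive N t))
    by (auto using tangent_unit, normal_unit, tangent_normal).
  rewrite dnormal_tangent, dnormal_normal by easy.
  rewrite !cross_plus_r, !cross_scal_r, cross_cross.
  rewrite normal_unit, (dot_comm (N t)), tangent_normal by easy.
  unfold darboux, torsion, binormal; rewrite alpha_unit by easy; fold T N.
  unfold Rdiv; rewrite Rinv_1; vec_ring.
Qed.

(** [N'] is orthogonal to the unit vector [N], so [N x N'] has the norm of [N'] and the two
    normalizations agree. *)
Lemma unit_darboux_eq t :
  D t -> unit_darboux alpha t =
         cross (N t) (scal (/ vnorm (vderive N t)) (vderive N t)).
Proof.
  intros Dt; unfold unit_darboux; rewrite darboux_eq, cross_scal_r by easy.
  f_equal; f_equal; unfold vnorm at 1; rewrite dot_cross_cross.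
  rewrite normal_unit, (dot_comm (N t)), dnormal_normal by easy.
  unfold vnorm; f_equal; ring.
Qed.

End Frenet.

(** * From the arc length of the curve to that of its Darboux indicatrix *)

Theorem theorem5 :
  forall (lo hi : Rbar) (alpha : R -> vec) (par : R -> R)
         (a theta sigma0 : R) (c : vec),
  let I := Rbar_interval lo hi in
  let J := image I (indicatrix_arclength alpha) in
  let gamma := gamma_C alpha par a theta sigma0 c in
  I 0 ->
  smooth_on I alpha ->
  (forall s : R, I s -> vnorm (vderive alpha s) = 1) ->
  curved_on I alpha ->
  regular_on I (unit_darboux alpha) ->
  (forall s : R, I s -> par (indicatrix_arclength alpha s) = s) ->
  J sigma0 ->
  sin theta <> 0 ->
  regular_on J gamma ->
  curved_on J gamma ->
  bertrand_curve J gamma /\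
  (cot theta <> 0 -> bertrand_relation J gamma).
Proof.
  intros lo hi alpha par a theta sigma0 c I J gamma I0 Salpha unit curved
    regC parK J0 _ regG curvG.
  pose proof (open_Rbar_interval lo hi) as Io.
  pose proof (convex_Rbar_interval lo hi) as Ic.
  fold I in Io, Ic; apply (smooth_on_iff I Io) in Salpha.
  destruct (spherical_frame_of_curve I (normal alpha) (unit_darboux alpha))
    as (U & w & g & F & w_pos); auto.
  { apply normal_smooth; auto. }
  { apply normal_unit; auto. }
  { apply dnormal_neq0; auto. }
  { apply unit_darboux_eq; auto. }
  assert (dC : forall t, I t -> vderive (unit_darboux alpha) t = scal (g t) (U t)).
  { intros t It; apply is_vderive_unique, (frame_dC F t It). }
  (* [C' = g U], so regularity of the Darboux indicatrix says that [g] has no zero. *)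
  destruct (constant_sign I g 0) as [e [He g_sign]]; auto.
  { intros t It; apply (smooth_continuity_pt I); auto; apply F. }
  { intros t It E; apply (regC t It); rewrite dC, E by easy; vec_ring. }
  set (speed := fun t => vnorm (vderive (unit_darboux alpha) t)).
  assert (speed_pos : forall t, I t -> 0 < speed t)
    by (intros t It; apply vnorm_pos; auto).
  assert (speed_eq : forall t, I t -> speed t = e * g t).
  { intros t It; unfold speed; rewrite dC, vnorm_scal by easy.
    rewrite (proj2 (vnorm_eq1 (U t)) (frame_UU F t It)), Rmult_1_r.
    specialize (g_sign t It); destruct He as [-> | ->].
    - rewrite Rabs_right; lra.
    - rewrite Rabs_left; lra. }
  assert (speed_smooth : smooth I speed).
  { apply smooth_vnorm; auto; apply vsmooth_vderive; auto; apply F. }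
  assert (dsigma : forall t, I t -> is_derive (indicatrix_arclength alpha) t (speed t)).
  { intros t It; apply (is_derive_RInt_on I Io speed); auto.
    intros x Ix; apply (smooth_continuity_pt I); auto. }
  pose proof (image_open lo hi _ _ _ dsigma speed_pos parK) as Jo.
  pose proof (image_convex lo hi _ _ dsigma speed_pos) as Jc.
  pose proof (is_derive_inverse lo hi _ _ _ dsigma speed_pos parK) as dpar.
  fold I J in Jo, Jc, dpar.
  assert (JI : forall t, J t -> I (par t))
    by (intros t Jt; apply (image_in lo hi _ _ parK t Jt)).
  assert (speed_neq0 : forall t, I t -> speed t <> 0)
    by (intros t It; generalize (speed_pos t It); lra).
  (* [par] was assumed only to be a left inverse of the arc length; its smoothness now follows from
     its derivative [/ speed (par t)]. *)
  pose proof (smooth_inverse I J speed par JI speed_smooth speed_neq0 dpar) as Spar.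
  assert (f_pos : forall t, J t -> 0 < / speed (par t) * w (par t)).
  { intros t Jt; apply Rmult_lt_0_compat; auto.
    apply Rinv_0_lt_compat; auto. }
  assert (dgamma : forall t, J t -> is_vderive gamma t
    (plus (scal a (unit_darboux alpha (par t)))
       (scal (a * cot theta) (normal alpha (par t))))).
  (* One coordinate of [gamma], with [x], [y], [d] standing for those of [C], [N] and the constant
     vector. *)
  { assert (K : forall (x y : R -> R) (d t : R), smooth I x -> smooth I y -> J t ->
      is_derive (fun u => a * RInt (fun v => x (par v)) sigma0 u +
        a * cot theta * RInt (fun v => y (par v)) sigma0 u + d) t
        (a * x (par t) + a * cot theta * y (par t))).
    { intros x y d t Sx Sy Jt.
      rewrite <- (Rplus_0_r (a * x (par t) + _)).
      apply (is_derive_plus (fun u => a * RInt (fun v => x (par v)) sigma0 u +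
        a * cot theta * RInt (fun v => y (par v)) sigma0 u) (fun _ => d));
        [|exact (is_derive_const d t)].
      apply (is_derive_plus (fun u => a * RInt (fun v => x (par v)) sigma0 u)
        (fun u => a * cot theta * RInt (fun v => y (par v)) sigma0 u));
        apply is_derive_scal;
        [apply (is_derive_RInt_on J Jo (fun v => x (par v)))
        |apply (is_derive_RInt_on J Jo (fun v => y (par v)))]; auto;
        intros u Ju; apply (smooth_continuity_pt J); auto;
        apply (smooth_comp I); auto. }
    destruct (frame_smooth_C _ _ _ _ _ _ F) as (C1 & C2 & C3).
    destruct (frame_smooth_N _ _ _ _ _ _ F) as (N1 & N2 & N3).
    intros t Jt; split; [|split].
    - exact (K _ _ (vx c) t C1 N1 Jt).
    - exact (K _ _ (vy c) t C2 N2 Jt).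
    - exact (K _ _ (vz c) t C3 N3 Jt). }
  (* In the parameter [sigma] the coefficient of [C'] becomes [g / speed = g / (e * g)], which
     equals [e] because [e] is 1 or -1. *)
  assert (F' : spherical_frame J (fun t => normal alpha (par t))
    (fun t => U (par t)) (fun t => unit_darboux alpha (par t))
    (fun t => / speed (par t) * w (par t)) (fun _ => e)).
  { apply (spherical_frame_comp I J _ U _ w g par (fun t => / speed (par t))); auto.
    - apply smooth_inv; auto; apply (smooth_comp I); auto.
    - intros t Jt; rewrite speed_eq by auto; specialize (g_sign _ (JI t Jt)).
      assert (g (par t) <> 0) by (intros E; rewrite E in g_sign; lra).
      destruct He as [-> | ->]; field; auto. }
  split.
  - exact (gamma_bertrand_curve J _ _ _ gamma _ e a (cot theta) sigma0
      Jo Jc J0 He F' f_pos dgamma regG curvG).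
  - exact (gamma_bertrand_relation J _ _ _ gamma _ e a (cot theta) sigma0
      Jo Jc J0 He F' dgamma regG curvG).
Qed.
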